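(* Let $\mathsf T,\mathsf E$ be real $2m\times2m$ matrices and let $J,\mathsf N$ be real $2m\times m$ matrices, with the $2m$ coordinates grouped into $m$ consecutive pairs. Suppose $I-\mathsf T$ is invertible, $J^*J=I$, and $\mathsf E\succeq\mathsf T^*\mathsf C\mathsf T$, where $\mathsf C=\bigoplus_{i=1}^m C_iI_2$ and $C_i>0$. Assume the $i$-th columns $j_i,n_i$ of $J,\mathsf N$ are supported on the $i$-th coordinate pair (and regard them as vectors in $\mathbb R^2$); let $\mathsf E_{ii},\mathsf T_{ii}$ denote the $i$-th diagonal $2\times2$ blocks. Choose real symmetric $2\times2$ matrices $W_i\succ0$, real $2\times2$ matrices $D_i$, and numbers $K_i>0$, $h_i\ge0$, and define $$B_i=D_i^*W_i^{-1},\quad U_i=W_i^{-1}D_iW_i,\quad R_i=\frac{B_i^*B_i}{4C_i},\quad d_i^*=j_i^*B_i+n_i^*W_i .$$ Suppose that for every $i$, $$\operatorname{tr}(\mathsf E_{ii}W_i^2)+\operatorname{tr}(D_i\mathsf T_{ii})\le h_i,\qquad \chi_i:=h_i+\operatorname{tr}R_i>0,\qquad \operatorname{Sym}U_i-h_iI_2-\operatorname{adj}R_i-\frac{d_id_i^*}{4K_i}\succeq0 .$$ Then there is a nonzero covariance of exact responses, i.e. a centered random pair $(\xi,y)\in\mathbb R^m\times\mathbb R^{2m}$ with finite second moments, not almost surely zero, satisfying $(I-\mathsf T)y=J\xi$ almost surely, for which $$\mathbb E\bigl(y^*\mathsf Ey+\xi^*\mathsf N^*y\bigr)\le\sum_{i=1}^mK_i\,\mathbb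 E\,\xi_i^2 .$$
   Context: $^*$ denotes transpose. For a real $2\times2$ matrix, $\operatorname{Sym}U=(U+U^* )/2$ and, for symmetric $R$, $\operatorname{adj}R=(\operatorname{tr}R)I_2-R$. $A\succeq B$ means $A-B$ is symmetric positive semidefinite. An ''exact response'' is a pair $(\xi,y)$ with $(I-\mathsf T)y=J\xi$. *)

(* Defs.v *)
From mathcomp Require Import all_boot all_order all_algebra.
From mathcomp Require Import all_classical all_reals all_analysis.

Set Implicit Arguments.
Unset Strict Implicit.
Unset Printing Implicit Defensive.

Import Order.TTheory GRing.Theory Num.Theory.

Local Open Scope ring_scope.

Section Coordinates.
Variable m : nat.

Fact coord_subproof (i : 'I_m) (a : 'I_2) : (2 * i + a < 2 * m)%N.
Proof.
have : (2 * i + a < 2 * i.+1)%N by rewrite mulnS addnC ltn_add2r.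
by move=> /leq_trans; apply; rewrite leq_mul2l /=.
Qed.

(* Zero-based: the [i]-th pair consists of the coordinates [2 i] and [2 i + 1]. *)
Definition coord (i : 'I_m) (a : 'I_2) : 'I_(2 * m) :=
  Ordinal (coord_subproof i a).

Fact pair_of_subproof (k : 'I_(2 * m)) : (k %/ 2 < m)%N.
Proof. by rewrite ltn_divLR // (mulnC m 2). Qed.

Definition pair_of (k : 'I_(2 * m)) : 'I_m := Ordinal (pair_of_subproof k).

Lemma coordK (i : 'I_m) (a : 'I_2) : pair_of (coord i a) = i.
Proof.
apply: val_inj; rewrite /= mulnC divnMDl //.
by rewrite divn_small ?ltn_ord // addn0.
Qed.

Lemma coord_surj (k : 'I_(2 * m)) : exists a : 'I_2, k = coord (pair_of k) a.
Proof.
exists (Ordinal (ltn_pmod k (isT : (0 < 2)%N))).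
by apply: val_inj; rewrite /= (mulnC 2 (k %/ 2)%N) -divn_eq.
Qed.

End Coordinates.

Section Matrices.
Variable R : realType.

Definition psd n (A : 'M[R]_n) : Prop :=
  A^T = A /\ forall x : 'cV[R]_n, 0 <= (x^T *m A *m x) 0 0.

Definition posdef n (A : 'M[R]_n) : Prop :=
  A^T = A /\ forall x : 'cV[R]_n, x != 0 -> 0 < (x^T *m A *m x) 0 0.

Definition loewner_ge n (A B : 'M[R]_n) : Prop := psd (A - B).

Definition Sym (U : 'M[R]_2) : 'M[R]_2 := 2^-1 *: (U + U^T).

Definition adj2 (A : 'M[R]_2) : 'M[R]_2 := (\tr A)%:M - A.

Variable m : nat.

Definition scalar_blocks (C : 'I_m -> R) : 'M[R]_(2 * m) :=
  diag_mx (\row_k C (pair_of k)).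

Definition diag_block (A : 'M[R]_(2 * m)) (i : 'I_m) : 'M[R]_2 :=
  \matrix_(a, b) A (coord i a) (coord i b).

Definition paired_support (A : 'M[R]_(2 * m, m)) : Prop :=
  forall k i, pair_of k != i -> A k i = 0.

Definition paired_col (A : 'M[R]_(2 * m, m)) (i : 'I_m) : 'cV[R]_2 :=
  \col_a A (coord i a) i.

Definition exact_response (T : 'M[R]_(2 * m)) (J : 'M[R]_(2 * m, m))
    (xi : 'cV[R]_m) (y : 'cV[R]_(2 * m)) : Prop :=
  (1%:M - T) *m y = J *m xi.

End Matrices.

Section RandomVectors.
Context d (Omega : measurableType d) (R : realType) (P : probability Omega R).

Definition rvec n (X : 'I_n -> {RV P >-> R}) (w : Omega) : 'cV[R]_n :=
  \col_k X k w.

Definition centered n (X : 'I_n -> {RV P >-> R}) : Prop :=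
  forall k, ('E_P[X k] = 0)%E.

Definition finite_second_moments n (X : 'I_n -> {RV P >-> R}) : Prop :=
  forall k, (X k : Omega -> R) \in Lfun P 2%:E.

End RandomVectors.

(* Main.v *)
Require Import Defs.
From mathcomp Require Import all_boot all_order all_algebra.
From mathcomp Require Import all_classical all_reals all_analysis.
From mathcomp Require Import ring lra.

Set Implicit Arguments.
Unset Strict Implicit.
Unset Printing Implicit Defensive.

Import Order.TTheory GRing.Theory Num.Theory.

Local Open Scope ring_scope.

(* Put t_i = 1 / chi_i and V = diag (sqrt t_i W_i), and let G be an orthonormal
   basis of V^-1 times the space of exact responses y. The m columns y = V g of
   V G are exact responses; Z = G G^T is the projection on them and P = 1 - Z
   the complementary one, so that the 2x2 diagonal blocks satisfy
   Z_ii + P_ii = 1. In each block, the semidefinite constraint tested on Z_ii,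
   with y_i - (T y)_i = xi_i j_i, bounds K_i xi_i^2 from below. The trace
   constraint splits into its Z and P parts, and the P part is absorbed by
   E >= T^* C T after completing a square. Summing the blocks leaves
   sum_i K_i E xi_i^2 - E (y^* E y + xi^* N^* y)
     >= sum_i t_i chi_i (tr Z_ii - 1) = tr Z - m = 0.
   This holds for the sum over the columns of G, hence for one of them; a
   random sign makes it centered. *)

(** * Congruence of positive definite matrices to the identity *)

Section Whitening.
Context {R : realType}.

(** Completing the square: for fixed [x], the chosen first coordinate cancels the terms in [b].
    Positivity thus passes from the block matrix to its Schur complement [S]. *)
Lemma schur_complement_form n (alpha : R) (b : 'rV[R]_n) (S : 'M[R]_n)
    (x : 'cV[R]_n) : alpha != 0 ->
  let u : 'cV[R]_(1 + n) := col_mx (- alpha^-1 *: (b *m x)) x in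
  u^T *m block_mx alpha%:M b b^T (S + alpha^-1 *: (b^T *m b)) *m u
  = x^T *m S *m x.
Proof.
move=> a0 u; rewrite /u tr_col_mx -mulmxA mul_block_col mul_row_col.
rewrite mul_scalar_mx scalerA mulrN divff // scaleN1r addNr mulmx0 add0r.
rewrite mulmxDl -scalemxAl -scalemxAr scaleNr mulmxA.
by rewrite addrC addrK mulmxA.
Qed.

Lemma block_whitening n (alpha : R) (b : 'rV[R]_n) (S H : 'M[R]_n) :
  0 < alpha -> H^T *m S *m H = 1%:M ->
  exists H' : 'M[R]_(1 + n),
    H'^T *m block_mx alpha%:M b b^T (S + alpha^-1 *: (b^T *m b)) *m H' = 1%:M.
Proof.
move=> a_gt0 HSH; have a0 : alpha != 0 by rewrite gt_eqF.
pose r := Num.sqrt alpha; have r0 : r != 0 by rewrite gt_eqF // sqrtr_gt0.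
have rr : r * r = alpha by rewrite -expr2 sqr_sqrtr // ltW.
(* Block upper triangular witness: [r^-1] normalizes the pivot, and the upper right block, the same
   completing-the-square shift, clears the off-diagonal blocks. *)
exists (block_mx (r^-1%:M : 'M[R]_1) (- alpha^-1 *: (b *m H)) 0 H).
rewrite (tr_block_mx (r^-1%:M : 'M[R]_1)) -mulmxA !mulmx_block.
rewrite trmx0 !mul0mx !mulmx0 !addr0 tr_scalar_mx.
rewrite -!scalar_mxM mulmxDl !mul_scalar_mx !mul_mx_scalar.
rewrite scalerA mulrN divff // scaleN1r addNr.
rewrite -!scalemxAl -!scalemxAr !scaleNr -!mulmxA (addrC (S *m H)) addKr.
rewrite scaler0 mulmx0 add0r mulmxA HSH linearN linearZ /= trmx_mul scalerN.
have ra : alpha / r / alpha = r^-1 by field; rewrite r0 a0.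
rewrite scalerA ra addNr.
have -> : r^-1 * (alpha * r^-1) = 1 by rewrite -rr; field.
by rewrite -(@scalar_mx_block _ 1 n).
Qed.

(** Induction on the size through the Schur complement of the first entry, as in Cholesky
    factorization. It serves twice: for the invertibility of the [W i] and to orthonormalize the
    responses. *)
Lemma posdef_whitening n (A : 'M[R]_n) :
  posdef A -> exists H : 'M[R]_n, H^T *m A *m H = 1%:M.
Proof.
elim: n A => [|n IHn] A [Asym Apos].
  by exists 1%:M; apply/matrixP => -[].
have [alpha [b [S [defA a_gt0]]]] : exists alpha (b : 'rV[R]_n) (S : 'M[R]_n),
    A = block_mx (alpha%:M : 'M[R]_1) b b^T (S + alpha^-1 *: (b^T *m b))
    /\ 0 < alpha.
  pose A' : 'M[R]_(1 + n) := A; pose alpha := ulsubmx A' 0 0.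
  exists alpha, (ursubmx A').
  exists (drsubmx A' - alpha^-1 *: ((ursubmx A')^T *m ursubmx A')); split.
    rewrite subrK -mx11_scalar; have -> : (ursubmx A')^T = dlsubmx A'.
      by rewrite trmx_ursub /A' Asym.
    by rewrite submxK.
  (* The first basis vector tests the sign of the pivot. *)
  have e0 : (delta_mx 0 0 : 'cV[R]_n.+1) != 0.
    apply/eqP => /matrixP /(_ 0 0); rewrite !mxE !eqxx => /eqP.
    by rewrite oner_eq0.
  have -> : alpha = A 0 0 by rewrite /alpha !mxE; congr (A _ _); apply: val_inj.
  by have := Apos _ e0; rewrite trmx_delta -rowE -colE !mxE.
have Sposdef : posdef S.
  split.
    move: Asym; rewrite defA (tr_block_mx (alpha%:M : 'M[R]_1)).
    move=> /(@eq_block_mx _ 1 n 1 n)[_ _ _].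
    by rewrite linearD linearZ /= trmx_mul trmxK => /addIr.
  move=> x x0; rewrite -(schur_complement_form b S x (lt0r_neq0 a_gt0)) -defA.
  apply: Apos; apply: contraNneq x0; rewrite -[0](@col_mx0 _ 1 n).
  by move=> /(@eq_col_mx _ 1 n 1)[_ ->].
have [H HSH] := IHn S Sposdef.
by rewrite defA; exact: block_whitening HSH.
Qed.

Lemma posdef_unitmx n (A : 'M[R]_n) : posdef A -> A \in unitmx.
Proof.
move=> /posdef_whitening[H]; rewrite -mulmxA => /mulmx1_unit[_].
by rewrite unitmx_mul => /andP[].
Qed.

End Whitening.

(** * The Frobenius inner product *)

Section Frobenius.
Context {R : realType}.

Definition frob m n (A B : 'M[R]_(m, n)) : R := \tr (A^T *m B).

Lemma frobC m n (A B : 'M[R]_(m, n)) : frob A B = frob B A.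
Proof. by rewrite /frob -mxtrace_tr trmx_mul trmxK. Qed.

Lemma frobDr m n (A B C : 'M[R]_(m, n)) : frob A (B + C) = frob A B + frob A C.
Proof. by rewrite /frob mulmxDr linearD. Qed.

Lemma frobBr m n (A B C : 'M[R]_(m, n)) : frob A (B - C) = frob A B - frob A C.
Proof. by rewrite /frob mulmxBr linearB. Qed.

Lemma frobZr m n a (A B : 'M[R]_(m, n)) : frob A (a *: B) = a * frob A B.
Proof. by rewrite /frob -scalemxAr linearZ. Qed.

Lemma frobDl m n (A B C : 'M[R]_(m, n)) : frob (B + C) A = frob B A + frob C A.
Proof. by rewrite !(frobC _ A) frobDr. Qed.

Lemma frobZl m n a (A B : 'M[R]_(m, n)) : frob (a *: A) B = a * frob A B.
Proof. by rewrite !(frobC _ B) frobZr. Qed.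

Lemma frobBl m n (A B C : 'M[R]_(m, n)) : frob (B - C) A = frob B A - frob C A.
Proof. by rewrite !(frobC _ A) frobBr. Qed.

Lemma frob_mull m n p (A : 'M[R]_(m, n)) (B : 'M[R]_(n, p)) (C : 'M[R]_(m, p)) :
  frob (A *m B) C = frob B (A^T *m C).
Proof. by rewrite /frob trmx_mul mulmxA. Qed.

Lemma frobE m n (A B : 'M[R]_(m, n)) :
  frob A B = \sum_k ((col k A)^T *m col k B) 0 0.
Proof.
apply: eq_bigr => k _; rewrite !mxE.
by apply: eq_bigr => i _; rewrite !mxE.
Qed.

Lemma frob_ge0 m n (A : 'M[R]_(m, n)) : 0 <= frob A A.
Proof.
apply: sumr_ge0 => k _; rewrite mxE sumr_ge0 // => i _.
by rewrite mxE -expr2 sqr_ge0.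
Qed.

Lemma frob_psd n p (M : 'M[R]_n) (G : 'M[R]_(n, p)) :
  psd M -> 0 <= frob G (M *m G).
Proof.
move=> [_ Mpos]; rewrite frobE sumr_ge0 // => k _.
have -> : col k (M *m G) = M *m col k G by rewrite !colE mulmxA.
by rewrite mulmxA.
Qed.

End Frobenius.

(** * Estimates in a single coordinate pair *)

Section Block.
Context {R : realType} {p : nat}.

(* The constraint is tested on the columns of [G], and [d^T G] is paired with
   [x] by AM-GM: [s f x <= s^2 f^2 / (4 K) + K x^2]. *)
Lemma block_gain (W D B U Rm : 'M[R]_2) (K h s : R) (j n d : 'cV[R]_2)
    (G Z : 'M[R]_(2, p)) (x : 'rV[R]_p) :
  0 < K -> W^T = W ->
  B = D^T *m invmx W -> U = invmx W *m D *m W ->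
  d^T = j^T *m B + n^T *m W ->
  psd (Sym U - h%:M - adj2 Rm - (4 * K)^-1 *: (d *m d^T)) ->
  s ^+ 2 * (h + \tr Rm) = 1 ->
  s *: (W *m G) = Z + j *m x ->
  frob (n^T *m (s *: (W *m G))) x + frob G G
    - s ^+ 2 * frob G (Rm *m G) - s * frob (B *m G) Z <= K * frob x x.
Proof.
move=> K0 Wsym defB defU defd Mpsd s2 exactG.
(* This form turns [frob G (U *m G)] into [frob (B *m G) (W *m G)], to which the response equation
   applies. *)
have defU' : U = B^T *m W by rewrite defU defB trmx_mul trmxK trmx_inv Wsym.
have := frob_psd G Mpsd.
rewrite /adj2 /Sym !mulmxBl !frobBr !mul_scalar_mx -!scalemxAl !frobZr.
rewrite mulmxDl frobDr -mulmxA.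
have -> : frob G (U^T *m G) = frob G (U *m G) by rewrite -frob_mull frobC.
rewrite {1 2}defU' -!mulmxA -!frob_mull.
have -> : frob G (d *m (d^T *m G)) = frob (d^T *m G) (d^T *m G).
  by rewrite (frob_mull d^T) trmxK.
have := frob_ge0 (s *: (d^T *m G) - (2 * K) *: x).
rewrite !(frobBr, frobBl, frobZl, frobZr) (frobC x).
have : s * frob (d^T *m G) x
    = s * frob (j^T *m (B *m G)) x + frob (n^T *m (s *: (W *m G))) x.
  rewrite defd mulmxDl frobDl -!mulmxA -scalemxAr frobZl.
  by rewrite mulrDr.
(* Pairing the response equation with [B *m G] leaves a [Z] term and a [j] term; the latter cancels
   the [j] part of [d^T]. *)
have : s * frob (B *m G) (W *m G)
    = frob (B *m G) Z + frob (j^T *m (B *m G)) x.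
  by rewrite -frobZr exactG frobDr (frob_mull j^T) trmxK.
move: (frob (d^T *m G) (d^T *m G)) (frob (d^T *m G) x) => F fx.
move: (frob (j^T *m _) x) (frob (n^T *m _) x) (frob x x) => jx nx xx.
move: (frob (B *m G) (W *m G)) (frob (B *m G) Z) => bw bz.
move: (frob G G) (frob G (Rm *m G)) (\tr Rm) s2 => gg gr tr s2 e1 e2.
move=> F0; have -> : 2^-1 * (bw + bw) = bw by field.
have K4 : 0 < 4 * K by rewrite mulr_gt0.
set q := (4 * K)^-1 * F => M0.
have F1 : 0 <= s ^+ 2 * q - s * fx + K * xx.
  rewrite -(pmulr_rge0 _ K4) /q.
  have -> : 4 * K * (s ^+ 2 * ((4 * K)^-1 * F) - s * fx + K * xx)
    = s * (s * F) - 2 * K * (s * fx) - 2 * K * (s * fx) + 4 * K * K * xx.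
    by field; rewrite gt_eqF.
  by move: F0; rewrite !mulrBr; lra.
have M1 : 0 <= s ^+ 2 * (bw - h * gg - (tr * gg - gr) - q).
  by rewrite mulr_ge0 // sqr_ge0.
(* Since the adjugate is trace minus matrix, [h] and [\tr Rm] collect into one coefficient of
   [frob G G], which the choice of [s] makes equal to 1. *)
have : s ^+ 2 * (bw - h * gg - (tr * gg - gr) - q)
  = s * (s * bw) - (s ^+ 2 * (h + tr)) * gg + s ^+ 2 * gr - s ^+ 2 * q by ring.
rewrite s2 e1 => M2; nra.
Qed.

(** Multiplied by [4 * C], the right-hand side is the squared norm of
    [(2 * C) *: Z + s *: (B *m Q)]. *)
Lemma block_loss (B : 'M[R]_2) (C s : R) (Q Z : 'M[R]_(2, p)) : 0 < C ->
  0 <= C * frob Z Z + s * frob (B *m Q) Z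
       + s ^+ 2 * frob Q (((4 * C)^-1 *: (B^T *m B)) *m Q).
Proof.
move=> C0; have := frob_ge0 ((2 * C) *: Z + s *: (B *m Q)).
rewrite !(frobDr, frobDl, frobZl, frobZr) (frobC Z) -scalemxAl frobZr.
rewrite -mulmxA -frob_mull => H.
have C4 : 0 < 4 * C by rewrite mulr_gt0.
rewrite -(pmulr_rge0 _ C4); move: H.
move: (frob Z Z) (frob (B *m Q) Z) (frob (B *m Q) (B *m Q)) => zz bz bb.
suff -> : 4 * C * (C * zz + s * bz + s ^+ 2 * ((4 * C)^-1 * bb))
  = 2 * C * (2 * C * zz + s * bz) + s * (2 * C * bz + s * bb) by nra.
by field; rewrite gt_eqF.
Qed.

End Block.

(** * Coordinate pairs and block diagonal matrices *)

Section Selection.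
Context {R : realType} {m : nat}.

(* [sel i *m A] is the pair of rows of [A] indexed by the [i]-th coordinate
   pair. [coord] is qualified because MathComp's [vector.coord] shadows it. *)
Definition sel (i : 'I_m) : 'M[R]_(2, 2 * m) :=
  \matrix_(a, k) (k == Defs.coord i a)%:R.

Lemma sel_mulE p (A : 'M[R]_(2 * m, p)) i a k :
  (sel i *m A) a k = A (Defs.coord i a) k.
Proof.
rewrite mxE (bigD1 (Defs.coord i a)) //= mxE eqxx mul1r big1 ?addr0 // => l lne.
by rewrite mxE (negPf lne) mul0r.
Qed.

Lemma coord_inj i : injective (@Defs.coord m i).
Proof. by move=> a b /(congr1 val)/= /addnI /val_inj. Qed.

Lemma mul_sel_tr i i' : sel i *m (sel i')^T = (i == i')%:R%:M.
Proof.
apply/matrixP => a b; rewrite sel_mulE !mxE.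
have [<-|ne] := eqVneq i i'; first by rewrite (inj_eq (@coord_inj i)).
have [/(congr1 (@pair_of m))|_] := eqVneq (Defs.coord i a) (Defs.coord i' b).
  by rewrite !coordK => /eqP; rewrite (negPf ne).
by rewrite mul0rn.
Qed.

Lemma sum_sel : \sum_i (sel i)^T *m sel i = 1%:M.
Proof.
apply/matrixP => k l; rewrite summxE.
have [a ka] := coord_surj k.
rewrite (bigD1 (pair_of k)) //= mxE (bigD1 a) //= !mxE -ka eqxx mul1r.
rewrite big1 => [|b bne]; last first.
  by rewrite !mxE {1}ka (inj_eq (@coord_inj _)) eq_sym (negPf bne) mul0r.
rewrite big1 => [|i ine]; first by rewrite !addr0 eq_sym.
rewrite mxE big1 // => b _; rewrite !mxE.
have [kb|_] := eqVneq; last by rewrite mul0r.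
by move: ine; rewrite kb coordK eqxx.
Qed.

Lemma diag_blockE (A : 'M[R]_(2 * m)) i :
  diag_block A i = sel i *m A *m (sel i)^T.
Proof.
apply/matrixP => a b; rewrite -mulmxA sel_mulE.
have -> : A *m (sel i)^T = (sel i *m A^T)^T by rewrite trmx_mul trmxK.
by rewrite [RHS]mxE sel_mulE !mxE.
Qed.

Lemma mul_sum_sel p q (A : 'M[R]_(p, 2 * m)) (B : 'M[R]_(2 * m, q)) :
  A *m B = \sum_i (A *m (sel i)^T) *m (sel i *m B).
Proof.
rewrite -[A in LHS]mulmx1 -sum_sel mulmx_sumr mulmx_suml.
by apply: eq_bigr => i _; rewrite !mulmxA.
Qed.

Lemma scalar_blocksE (C : 'I_m -> R) :
  scalar_blocks C = \sum_i C i *: ((sel i)^T *m sel i).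
Proof.
rewrite /scalar_blocks -[diag_mx _]mul1mx -sum_sel mulmx_suml.
apply: eq_bigr => i _; rewrite -mulmxA scalemxAr; congr (_ *m _).
apply/matrixP => a k; rewrite sel_mulE !mxE mulr_natr eq_sym.
by rewrite coordK.
Qed.

Lemma sel_paired (A : 'M[R]_(2 * m, m)) i :
  paired_support A -> sel i *m A = paired_col A i *m row i 1%:M.
Proof.
move=> suppA; apply/matrixP => a k.
rewrite sel_mulE mxE big_ord1 !mxE mulr_natr.
have [->|ne] := eqVneq i k; first by [].
by apply: suppA; rewrite coordK.
Qed.

(** Built from [sel], so that block computations reduce to [mul_sel_tr] and [sum_sel]. *)
Definition blockdiag (F : 'I_m -> 'M[R]_2) : 'M[R]_(2 * m) :=
  \sum_i (sel i)^T *m F i *m sel i.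

Lemma sel_blockdiag F i : sel i *m blockdiag F = F i *m sel i.
Proof.
rewrite mulmx_sumr (bigD1 i) //= big1 => [|j jne].
  by rewrite addr0 !mulmxA mul_sel_tr eqxx mul1mx.
by rewrite !mulmxA mul_sel_tr eq_sym (negPf jne) mul_scalar_mx scale0r !mul0mx.
Qed.

Lemma tr_blockdiag F : (blockdiag F)^T = blockdiag (fun i => (F i)^T).
Proof.
rewrite linear_sum; apply: eq_bigr => i _ /=.
by rewrite !trmx_mul trmxK mulmxA.
Qed.

Lemma blockdiag_unit F :
  (forall i, F i \in unitmx) -> blockdiag F \in unitmx.
Proof.
move=> Fu; have /mulmx1_unit[//] :
    blockdiag F *m blockdiag (fun i => invmx (F i)) = 1%:M.
rewrite -sum_sel mulmx_suml; apply: eq_bigr => i _.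
by rewrite -mulmxA sel_blockdiag mulmxA mulmxK.
Qed.

End Selection.

(** * From the block estimates to the global energy bound *)

Section Tight.
Context {R : realType} {m : nat}.
Implicit Types (T E V P : 'M[R]_(2 * m)) (G : 'M[R]_(2 * m, m)).

Lemma frob_sel p (A B : 'M[R]_(2 * m, p)) :
  frob A B = \sum_i frob (sel i *m A) (sel i *m B).
Proof.
rewrite /frob mul_sum_sel linear_sum; apply: eq_bigr => i _ /=.
by rewrite trmx_mul.
Qed.

Lemma mxtrace_resolution n p q (M : 'M[R]_n)
    (g : 'M[R]_(n, p)) (k : 'M[R]_(n, q)) :
  g *m g^T + k *m k^T = 1%:M -> \tr M = frob g (M *m g) + frob k (M *m k).
Proof.
move=> gk; rewrite -[M in LHS]mulmx1 -gk mulmxDr linearD /= /frob.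
by rewrite !mulmxA !(mxtrace_mulC (M *m _)) !mulmxA.
Qed.

Lemma sel_resolution G P i : G *m G^T + P *m P^T = 1%:M ->
  (sel i *m G) *m (sel i *m G)^T + (sel i *m P) *m (sel i *m P)^T
  = 1%:M :> 'M[R]_2.
Proof.
move=> GP; rewrite !trmx_mul !mulmxA -mulmxDl -!(mulmxA (sel i)) -mulmxDr.
by rewrite GP mulmx1 mul_sel_tr eqxx.
Qed.

(** From [G^T *m P = 0], [P] is a symmetric idempotent. The square projection itself stands in for
    an orthonormal basis of the complement, so none has to be chosen. *)
Lemma orthonormal_complement G : G^T *m G = 1%:M ->
  let P := 1%:M - G *m G^T in G *m G^T + P *m P^T = 1%:M.
Proof.
move=> GG P; have Psym : P^T = P.
  by rewrite /P linearB /= trmx_mul trmxK trmx1.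
have GP : G^T *m P = 0 by rewrite mulmxBr mulmx1 mulmxA GG mul1mx subrr.
by rewrite Psym {1}/P mulmxBl mul1mx -mulmxA GP mulmx0 subr0 subrKC.
Qed.

(** Substituting [D = W *m B^T] and moving [s *: W] across [sel i] as [V] makes the [T] term a trace
    of [B^T] against a block of [T *m V]; the resolution of the identity then splits it. *)
Lemma local_budget T E V G P (W D : 'M[R]_2) (s : R) i :
  G *m G^T + P *m P^T = 1%:M ->
  V *m (sel i)^T = (sel i)^T *m (s *: W) -> W^T = W -> W \in unitmx ->
  let B := D^T *m invmx W in
  s ^+ 2 * (\tr (diag_block E i *m (W *m W)) + \tr (D *m diag_block T i))
  = \tr (sel i *m E *m V *m V *m (sel i)^T)
    + s * frob (B *m (sel i *m G)) (sel i *m T *m V *m G)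
    + s * frob (B *m (sel i *m P)) (sel i *m T *m V *m P).
Proof.
move=> GP Vsel Wsym Wu B.
rewrite !diag_blockE mulrDr -addrA; congr (_ + _).
  rewrite -!mulmxA Vsel (mulmxA V) Vsel -!mulmxA -!scalemxAl -!scalemxAr.
  by rewrite scalerA !linearZ /= expr2 !mulmxA.
have DB : D = W *m B^T by rewrite /B trmx_mul trmxK trmx_inv Wsym mulKVmx.
rewrite -mulrDr expr2 -mulrA; congr (_ * _).
have -> : s * \tr (D *m (sel i *m T *m (sel i)^T))
    = \tr (B^T *m (sel i *m T *m V) *m (sel i)^T).
  rewrite -(mulmxA B^T) -(mulmxA _ V) Vsel DB -[in LHS]mulmxA mxtrace_mulC.
  by rewrite -!scalemxAr linearZ /= !mulmxA.
have traceE q (Q : 'M[R]_(2 * m, q)) :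
    frob (B *m (sel i *m Q)) (sel i *m T *m V *m Q)
    = \tr (B^T *m (sel i *m T *m V) *m (Q *m Q^T) *m (sel i)^T).
  by rewrite /frob 2!trmx_mul mxtrace_mulC !mulmxA (mxtrace_mulC _ B^T) !mulmxA.
by rewrite !traceE -linearD -mulmxDl -mulmxDr GP mulmx1.
Qed.

Lemma frob_scalar_blocks p (C : 'I_m -> R) (A : 'M[R]_(2 * m, p)) :
  frob A (scalar_blocks C *m A)
  = \sum_i C i * frob (sel i *m A) (sel i *m A).
Proof.
rewrite scalar_blocksE mulmx_suml /frob mulmx_sumr linear_sum /=.
apply: eq_bigr => i _.
by rewrite -scalemxAl -scalemxAr linearZ /= trmx_mul !mulmxA.
Qed.

(** Both sides are [\tr (V *m E *m V)], computed once along [G] and [P] and once along the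
    coordinate pairs. *)
Lemma frob_resolution E V G P : V^T = V -> G *m G^T + P *m P^T = 1%:M ->
  frob (V *m G) (E *m (V *m G)) + frob (V *m P) (E *m (V *m P))
  = \sum_i \tr (sel i *m E *m V *m V *m (sel i)^T).
Proof.
move=> Vsym GP.
have -> : \sum_i \tr (sel i *m E *m V *m V *m (sel i)^T) = \tr (V *m E *m V).
  rewrite -!mulmxA [RHS]mxtrace_mulC -[E *m V *m V]mul1mx -sum_sel.
  rewrite mulmx_suml linear_sum; apply: eq_bigr => i _ /=.
  by rewrite -(mulmxA _ (sel i)) [RHS]mxtrace_mulC !mulmxA.
rewrite (mxtrace_resolution _ GP) /frob.
by rewrite !trmx_mul Vsym !mulmxA.
Qed.

Lemma energy_bound T E (J N : 'M[R]_(2 * m, m)) (X : 'M[R]_m)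
    (C : 'I_m -> R) (W D : 'I_m -> 'M[R]_2) (K h s : 'I_m -> R)
    (B U Rm : 'I_m -> 'M[R]_2) (d : 'I_m -> 'cV[R]_2) G :
  let V := blockdiag (fun i => s i *: W i) in
  (forall i, 0 < C i) -> loewner_ge E (T^T *m scalar_blocks C *m T) ->
  paired_support J -> paired_support N ->
  (forall i, posdef (W i)) -> (forall i, 0 < K i) ->
  (forall i, B i = (D i)^T *m invmx (W i)) ->
  (forall i, U i = invmx (W i) *m D i *m W i) ->
  (forall i, Rm i = (4 * C i)^-1 *: ((B i)^T *m B i)) ->
  (forall i, (d i)^T = (paired_col J i)^T *m B i + (paired_col N i)^T *m W i) ->
  (forall i, \tr (diag_block E i *m (W i *m W i)) + \tr (D i *m diag_block T i)
     <= h i) ->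
  (forall i, psd (Sym (U i) - (h i)%:M - adj2 (Rm i)
     - (4 * K i)^-1 *: (d i *m (d i)^T))) ->
  (forall i, s i ^+ 2 * (h i + \tr (Rm i)) = 1) ->
  G^T *m G = 1%:M -> (1%:M - T) *m (V *m G) = J *m X ->
  frob (V *m G) (E *m (V *m G)) + frob (N^T *m (V *m G)) X
    <= \sum_i K i * frob (row i X) (row i X).
Proof.
move=> V hC hE suppJ suppN hW hK defB defU defR defd htr hpsd s2 GG exactG.
set P := 1%:M - G *m G^T; have GP : G *m G^T + P *m P^T = 1%:M.
  exact: orthonormal_complement.
have Wsym i : (W i)^T = W i by have [] := hW i.
have Wu i : W i \in unitmx by apply: posdef_unitmx.
have selV i : sel i *m V = (s i *: W i) *m sel i by rewrite sel_blockdiag.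
have Vsym : V^T = V.
  by rewrite tr_blockdiag; apply: eq_bigr => i _; rewrite linearZ /= Wsym.
have Vsel i : V *m (sel i)^T = (sel i)^T *m (s i *: W i).
  by rewrite -{1}Vsym -trmx_mul selV trmx_mul linearZ /= Wsym.
pose loss i := C i * frob (sel i *m T *m V *m P) (sel i *m T *m V *m P).
pose cross i :=
  frob ((paired_col N i)^T *m (s i *: (W i *m (sel i *m G)))) (row i X).
pose budget i := \tr (sel i *m E *m V *m V *m (sel i)^T).
(* The [1] is [s i ^+ 2 * (h i + \tr (Rm i))], with [\tr (Rm i)] split along [G] and [P]. The [B]
   terms along [G] cancel between gain and budget; those along [P] are absorbed by [loss i]. *)
have local i : cross i + frob (sel i *m G) (sel i *m G) + budget i - 1 - loss i
    <= K i * frob (row i X) (row i X).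
  have selG : s i *: (W i *m (sel i *m G))
      = sel i *m T *m V *m G + paired_col J i *m row i X.
    rewrite scalemxAl mulmxA -selV -!mulmxA.
    have -> : paired_col J i *m row i X = sel i *m (J *m X).
      by rewrite mulmxA sel_paired // -mulmxA -row_mul mul1mx.
    by rewrite -exactG mulmxBl mul1mx -mulmxDr subrKC.
  have gain := block_gain (hK i) (Wsym i) (defB i) (defU i) (defd i) (hpsd i)
    (s2 i) selG.
  have := block_loss (B i) (s i) (sel i *m P) (sel i *m T *m V *m P) (hC i).
  rewrite -defR => Loss.
  have := ler_wpM2l (sqr_ge0 (s i)) (htr i).
  rewrite (local_budget _ _ _ GP (Vsel i) (Wsym i) (Wu i)) -defB => Budget.
  have := mxtrace_resolution (Rm i) (sel_resolution i GP) => trR.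
  have := s2 i; rewrite mulrDr trR => s2h.
  rewrite /cross /budget /loss; move: gain Loss Budget s2h; nra.
have : \sum_i (cross i + frob (sel i *m G) (sel i *m G) + budget i - 1 - loss i)
    <= \sum_i K i * frob (row i X) (row i X) by apply: ler_sum.
apply: le_trans.
rewrite !(big_split, sumrN) /= -frob_sel -(frob_resolution E Vsym GP).
(* Orthonormality of the [m] columns cancels the [m] subtracted ones. *)
have -> : frob G G = \sum_(i < m) 1.
  by rewrite /frob GG mxtrace1 sumr_const card_ord.
have -> : \sum_i cross i = frob (N^T *m (V *m G)) X.
  rewrite frob_mull trmxK frob_sel; apply: eq_bigr => i _.
  rewrite /cross frob_mull trmxK scalemxAl mulmxA -selV mulmxA; congr frob.
  by rewrite [RHS]mulmxA sel_paired // -mulmxA -row_mul mul1mx.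
(* The budgets sum to the energies of [V *m G] and [V *m P]. The Loewner bound, tested on the
   columns of [V *m P], lets the second energy pay for all losses. *)
have : \sum_i loss i <= frob (V *m P) (E *m (V *m P)).
  have := frob_psd (V *m P) hE; rewrite mulmxBl frobBr -!mulmxA.
  rewrite (mulmxA T) -frob_mull -(mulmxA T) frob_scalar_blocks subr_ge0.
  by apply: le_trans; apply: ler_sum => i _; rewrite /loss !mulmxA.
lra.
Qed.

End Tight.

(** * A fair random sign *)

Section Rademacher.
Context {R : realType}.

Definition fair_coin : probability bool R := bernoulli_prob (2^-1 : R).

Definition rademacher (b : bool) : R := if b then 1 else - 1.

Lemma sqr_rademacher b : rademacher b ^+ 2 = 1.
Proof. by case: b; rewrite /rademacher ?sqrrN expr1n. Qed.

Lemma Lfun_rademacher : rademacher \in Lfun fair_coin 2%:E.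
Proof.
rewrite inE/=; apply/andP; split; rewrite inE//=.
rewrite /finite_norm unlock poweR_lty//.
rewrite (_ : (fun x => _) = cst 1%E); last first.
  by apply/funext; case=> /=; rewrite ?normrN normr1 powR1.
rewrite integral_cst //= mul1e.
exact: le_lt_trans (probability_le1 fair_coin measurableT) (ltry _).
Qed.

Lemma Lfun1_rademacher : rademacher \in Lfun fair_coin 1.
Proof.
apply: Lfun_subset12; last exact: Lfun_rademacher.
exact: fin_num_measure.
Qed.

Lemma expectation_rademacher : ('E_fair_coin[rademacher] = 0)%E.
Proof.
(* The Bernoulli integral formula is applied to a nonnegative integrand, hence the shift by 1. *)
have : ('E_fair_coin[(rademacher \+ cst 1)%R] = 1)%E.
  rewrite unlock integral_bernoulli_prob; first last.
  - by case=> /=; rewrite lee_fin ?addNr // addr_ge0.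
  - by rewrite invr_ge0 ler0n /= invf_le1 // ler1n.
  rewrite /= addNr mule0 adde0 -EFinM; congr (_%:E).
  by field.
rewrite expectationD ?Lfun1_rademacher ?Lfun_cst // expectation_cst.
(* Finiteness allows the shift to be cancelled among extended reals. *)
have := expectation_fin_num Lfun1_rademacher.
case: ('E_fair_coin[rademacher])%E => // r _ [] r1.
by congr (_%:E); lra.
Qed.

Lemma measurable_scaled_rademacher (a : R) :
  measurable_fun setT (a \o* rademacher)%R.
Proof. by []. Qed.

Definition scaled_rademacher (a : R) : {RV fair_coin >-> R} :=
  mfun_Sub (mem_set (measurable_scaled_rademacher a)).

End Rademacher.

(** * Orthonormal responses and the choice of one column *)

Section Existence.
Context {R : realType} {m : nat}.

(** The response map [A] has the left inverse [J^T *m (1%:M - T) *m V], so its Gram matrix is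
    positive definite. Whitening that matrix by [H] gives [X = H] and [G = A *m H]. *)
Lemma orthonormal_responses (T V : 'M[R]_(2 * m)) (J : 'M[R]_(2 * m, m)) :
  1%:M - T \in unitmx -> V \in unitmx -> J^T *m J = 1%:M ->
  exists (X : 'M[R]_m) (G : 'M[R]_(2 * m, m)),
    [/\ X \in unitmx, G^T *m G = 1%:M & (1%:M - T) *m (V *m G) = J *m X].
Proof.
move=> Tu Vu JJ; pose A := invmx V *m invmx (1%:M - T) *m J.
have JA : J^T *m (1%:M - T) *m V *m A = 1%:M.
  by rewrite /A -!mulmxA (mulKVmx Vu) (mulKVmx Tu).
have [|H HAAH] := @posdef_whitening R m (A^T *m A).
  split=> [|x x0]; first by rewrite trmx_mul trmxK.
  rewrite mulmxA -mulmxA -trmx_mul mxE lt_neqAle eq_sym; apply/andP; split.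
    apply: contra x0 => Ax0; rewrite -[x]mul1mx -JA -mulmxA.
    suff -> : A *m x = 0 by rewrite mulmx0.
    apply/colP => k; rewrite [RHS]mxE; apply/eqP.
    move: Ax0; rewrite psumr_eq0 => [|i _]; last by rewrite mxE -expr2 sqr_ge0.
    by move=> /allP/(_ k); rewrite mem_index_enum mxE mulf_eq0 orbb; apply.
  by rewrite sumr_ge0 // => i _; rewrite mxE -expr2 sqr_ge0.
exists H, (A *m H); split; first by have [] := mulmx1_unit HAAH.
  by rewrite trmx_mul -mulmxA (mulmxA A^T) mulmxA.
by rewrite /A -!mulmxA (mulKVmx Vu) (mulKVmx Tu).
Qed.

(** Both sides are sums over columns, so failure in every column would contradict the total; [0 < m]
    keeps the summed inequality strict. *)
Lemma column_below (E : 'M[R]_(2 * m)) (N Y : 'M[R]_(2 * m, m)) (X : 'M[R]_m)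
    (K : 'I_m -> R) : (0 < m)%N ->
  frob Y (E *m Y) + frob (N^T *m Y) X
    <= \sum_i K i * frob (row i X) (row i X) ->
  exists k, ((col k Y)^T *m E *m col k Y + (col k X)^T *m N^T *m col k Y) 0 0
    <= \sum_i K i * (col k X) i 0 ^+ 2.
Proof.
move=> m0 le; apply/existsP; apply: contraTT le; rewrite negb_exists -ltNge.
move=> /forallP gt; rewrite (frobC (N^T *m Y)).
have -> : \sum_i K i * frob (row i X) (row i X)
    = \sum_k \sum_i K i * (col k X) i 0 ^+ 2.
  rewrite exchange_big; apply: eq_bigr => i _; rewrite -mulr_sumr.
  congr (_ * _).
  by apply: eq_bigr => k _; rewrite mxE big_ord1 !mxE expr2.
have -> : frob Y (E *m Y) + frob X (N^T *m Y) = \sum_k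
    ((col k Y)^T *m E *m col k Y + (col k X)^T *m N^T *m col k Y) 0 0.
  rewrite !frobE -big_split; apply: eq_bigr => k _ /=; rewrite [RHS]mxE.
  by rewrite !(colE _ (_ *m Y)) -!(mulmxA _ Y) -!colE !mulmxA.
apply: ltr_sum => [|k _]; last by rewrite ltNge.
by apply/hasP; exists (Ordinal m0) => //; rewrite mem_index_enum.
Qed.

End Existence.

(** * Centering a deterministic response by a random sign *)

Section Randomize.
Context {R : realType}.
Local Notation P := (@fair_coin R).

Lemma rvec_scaled_rademacher n (x : 'cV[R]_n) b :
  rvec (fun i => scaled_rademacher (x i 0)) b = rademacher b *: x.
Proof. by apply/colP => i; rewrite !mxE. Qed.

Lemma centered_scaled_rademacher n (x : 'cV[R]_n) :
  centered (fun i => scaled_rademacher (x i 0)).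
Proof.
move=> i; rewrite (_ : (scaled_rademacher (x i 0) : bool -> R)
  = (x i 0 \o* rademacher)%R) //.
by rewrite expectationZl ?Lfun1_rademacher // expectation_rademacher mule0.
Qed.

Lemma finite_second_moments_scaled_rademacher n (x : 'cV[R]_n) :
  finite_second_moments (fun i => scaled_rademacher (x i 0)).
Proof.
by move=> i; apply: Lfun_scale; [rewrite ler1n | exact: Lfun_rademacher].
Qed.

(** The sign never vanishes, so an exceptional null set would contain both outcomes and the whole
    space would have probability 0. *)
Lemma not_ae_zero_scaled_rademacher n p (x : 'cV[R]_n) (y : 'cV[R]_p) :
  x != 0 ->
  ~ {ae P, forall w, rvec (fun i => scaled_rademacher (x i 0)) w = 0
                  /\ rvec (fun i => scaled_rademacher (y i 0)) w = 0}.
Proof.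
move=> x0 [A [mA A0 subA]].
have AT : A = setT.
  apply/seteqP; split=> // b _; apply: subA => /= -[].
  rewrite rvec_scaled_rademacher => /eqP; rewrite scaler_eq0 (negPf x0) orbF.
  move=> /eqP r0 _; have /eqP := @sqr_rademacher R b.
  by rewrite r0 expr0n eq_sym oner_eq0.
have := probability_setT P; rewrite -AT A0 => /eqP.
by rewrite eqe eq_sym oner_eq0.
Qed.

End Randomize.

Theorem lemma3p2 (R : realType) (m : nat) (hm : (0 < m)%N)
    (T E : 'M[R]_(2 * m)) (J N : 'M[R]_(2 * m, m)) (C : 'I_m -> R)
    (hT : 1%:M - T \in unitmx)
    (hJ : J^T *m J = 1%:M)
    (hC : forall i, 0 < C i)
    (hE : loewner_ge E (T^T *m scalar_blocks C *m T))
    (suppJ : paired_support J) (suppN : paired_support N)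
    (W D : 'I_m -> 'M[R]_2) (K h : 'I_m -> R)
    (hW : forall i, posdef (W i))
    (hK : forall i, 0 < K i)
    (hh : forall i, 0 <= h i)
    (B U Rm : 'I_m -> 'M[R]_2) (d : 'I_m -> 'cV[R]_2) (chi : 'I_m -> R)
    (defB : forall i, B i = (D i)^T *m invmx (W i))
    (defU : forall i, U i = invmx (W i) *m D i *m W i)
    (defR : forall i, Rm i = (4 * C i)^-1 *: ((B i)^T *m B i))
    (defd : forall i,
       (d i)^T = (paired_col J i)^T *m B i + (paired_col N i)^T *m W i)
    (defchi : forall i, chi i = h i + \tr (Rm i))
    (htr : forall i,
       \tr (diag_block E i *m (W i *m W i)) + \tr (D i *m diag_block T i) <= h i)
    (hchi : forall i, 0 < chi i)
    (hpsd : forall i,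
       psd (Sym (U i) - (h i)%:M - adj2 (Rm i)
            - (4 * K i)^-1 *: (d i *m (d i)^T))) :
  exists (disp : measure_display) (Omega : measurableType disp)
         (P : probability Omega R)
         (xi : 'I_m -> {RV P >-> R}) (y : 'I_(2 * m) -> {RV P >-> R}),
    [/\ centered xi /\ centered y,
        finite_second_moments xi /\ finite_second_moments y,
        ~ {ae P, forall w, rvec xi w = 0 /\ rvec y w = 0},
        {ae P, forall w, exact_response T J (rvec xi w) (rvec y w)}
      & ('E_P[fun w => (((rvec y w)^T *m E *m rvec y w
                         + (rvec xi w)^T *m N^T *m rvec y w) 0 0)%R]
         <= \sum_(i < m) (K i)%:E * 'E_P[fun w => (xi i w ^+ 2)%R])%E].
Proof.
(* [s i] is the root of the weight [t_i] and scales [W i] inside [V]. *)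
pose s i := Num.sqrt (chi i)^-1.
have s_gt0 i : 0 < s i by rewrite sqrtr_gt0 invr_gt0.
have s2 i : s i ^+ 2 * (h i + \tr (Rm i)) = 1.
  by rewrite -defchi sqr_sqrtr ?invr_ge0 ?ltW // mulVf // gt_eqF.
have Vu : blockdiag (fun i => s i *: W i) \in unitmx.
  apply: blockdiag_unit => i; rewrite unitmxZ ?unitfE ?gt_eqF //.
  exact: posdef_unitmx.
have [X [G [Xu GG exactG]]] := orthonormal_responses hT Vu hJ.
have := energy_bound hC hE suppJ suppN hW hK defB defU defR defd htr hpsd s2
  GG exactG.
move=> /(column_below hm)[k]; set Y := _ *m G.
set x := col k X; set y := col k Y => energy.
(* A zero column of the invertible [X] would make a diagonal entry of [invmx X *m X] vanish. *)
have x0 : x != 0.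
  apply/eqP => x0.
  have /matrixP/(_ k k) : invmx X *m X = 1%:M by rewrite mulVmx.
  move=> /eqP; have -> : (invmx X *m X) k k = (invmx X *m x) k 0.
    by rewrite !mxE; apply: eq_bigr => i _; rewrite !mxE.
  by rewrite x0 mulmx0 !mxE eqxx eq_sym oner_eq0.
have exact_xy : exact_response T J x y.
  by rewrite /exact_response /x /y !colE !mulmxA -exactG !mulmxA.
exists _, bool, fair_coin, (fun i => scaled_rademacher (x i 0)),
  (fun i => scaled_rademacher (y i 0)); split.
- by split; apply: centered_scaled_rademacher.
- by split; apply: finite_second_moments_scaled_rademacher.
- exact: not_ae_zero_scaled_rademacher.
- apply: aeW => b; rewrite /exact_response !rvec_scaled_rademacher -!scalemxAr.
  by rewrite exact_xy.
(* Both integrands are quadratic in the sign, hence constant, and the claim becomes the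
   deterministic [energy]. *)
rewrite [X in ('E_fair_coin[X] <= _)%E](_ : _ =
    cst ((y^T *m E *m y + x^T *m N^T *m y) 0 0)); last first.
  apply/funext => b; rewrite !rvec_scaled_rademacher !linearZ /= -!scalemxAl.
  by rewrite !scalerA -scalerDr -expr2 sqr_rademacher scale1r.
under eq_bigr => i _.
  rewrite [X in ('E_fair_coin[X])%E](_ : _ = cst (x i 0 ^+ 2)); last first.
    by apply/funext => b /=; rewrite exprMn sqr_rademacher mul1r.
  rewrite expectation_cst -EFinM; over.
by rewrite expectation_cst sumEFin lee_fin.
Qed.
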